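(* Let $P$ be a finite poset on two or more points and let $x$ be an element of $P$. Then $\operatorname{bdim}(P)\le 3+\operatorname{bdim}(P-\{x\})$.
   Context: $P-\{x\}$ is the subposet of $P$ on the remaining points. Boolean dimension: for a poset $P$, let $\mathcal{B}=\{L_1,\dots,L_d\}$ be a non-empty family of linear orders on the ground set of $P$ (not necessarily linear extensions) and $\tau:\{0,1\}^d\to\{0,1\}$. For distinct $x,y$, $q(x,y,\mathcal{B})\in\{0,1\}^d$ has $i$-th coordinate $1$ iff $x<y$ in $L_i$. $(\mathcal{B},\tau)$ is a Boolean realizer if for all distinct $x,y$: $x<y$ in $P$ iff $\tau(q(x,y,\mathcal{B}))=1$. $\operatorname{bdim}(P)$ is the least $d$ for which $P$ has a Boolean realizer with $|\mathcal{B}|=d$. *)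

(* Defs.v *)
From HB Require Import structures.
From mathcomp Require Import all_boot all_order.
From mathcomp Require Import boolp.

Set Implicit Arguments.
Unset Strict Implicit.
Unset Printing Implicit Defensive.

Import Order.TTheory.

Definition linear_order (T : Type) (L : rel T) : Prop :=
  [/\ reflexive L, antisymmetric L, transitive L & total L].

(* The orders [L i] are reflexive, so [L i x y] means "x < y in L_i" only for
   distinct x and y; [query] is used only at such pairs. *)
Definition query (T : Type) (d : nat) (L : 'I_d -> rel T) (x y : T) :
  d.-tuple bool := [tuple L i x y | i < d].

(* The linear orders are arbitrary: they need not extend the order of P. *)
Definition boolean_realizer (disp : Order.disp_t) (P : finPOrderType disp)
    (d : nat) (L : 'I_d -> rel P) (tau : d.-tuple bool -> bool) : Prop :=
  (forall i, linear_order (L i)) /\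
  (forall x y : P, x <> y -> (x < y)%O <-> tau (query L x y) = true).

Definition has_boolean_realizer (disp : Order.disp_t) (P : finPOrderType disp)
    (d : nat) : Prop :=
  0 < d /\
  exists (L : 'I_d -> rel P) (tau : d.-tuple bool -> bool),
    boolean_realizer L tau.

Lemma linear_order_key (T : Type) (f : T -> nat) :
  injective f -> linear_order (fun x y => f x <= f y).
Proof.
move=> f_inj; split=> [x|x y|y x z|x y].
- exact: leqnn.
- by rewrite -eqn_leq => /eqP /f_inj.
- exact: leq_trans.
- exact: leq_total.
Qed.

(* Existence of a Boolean realizer: take one linear order, and for each point
   [a] the two orders obtained by moving [a] to the bottom and to the top.
   Their values at (x, y) determine the pair (x, y). *)
Section Existence.
Variables (disp : Order.disp_t) (P : finPOrderType disp).

Definition move_key (o : option (P * bool)) (z : P) : nat :=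
  match o with
  | None => enum_rank z
  | Some (a, b) =>
      if z == a then (if b then 0 else #|P|.+1) else (enum_rank z).+1
  end.

Lemma move_key_inj o : injective (move_key o).
Proof.
case: o => [[a b]|] y z /=; last by move=> /val_inj /enum_rank_inj.
have lt_rank (t : P) : enum_rank t < #|P| by [].
case: eqVneq => [->|nya]; case: eqVneq => [->|nza] //; case: b => //.
- by case=> eq_r; move: (lt_rank z); rewrite -eq_r ltnn.
- by case=> eq_r; move: (lt_rank y); rewrite eq_r ltnn.
- by case=> /val_inj /enum_rank_inj.
- by case=> /val_inj /enum_rank_inj.
Qed.

Definition move_order (i : 'I_#|{: option (P * bool)}|) : rel P :=
  fun x y => move_key (enum_val i) x <= move_key (enum_val i) y.

Lemma query_move_inj (x y x' y' : P) :
    x != y -> x' != y' ->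
    query move_order x y = query move_order x' y' ->
  x = x' /\ y = y'.
Proof.
move=> nxy nxy' eq_q.
have eq_o o : (move_key o x <= move_key o y) =
              (move_key o x' <= move_key o y').
  have := congr1 (fun t => tnth t (enum_rank o)) eq_q.
  by rewrite !tnth_mktuple /move_order enum_rankK.
have ltF (t : P) : (#|P| < (enum_rank t).+1) = false.
  by apply/negbTE; rewrite ltnS -ltnNge.
have nyx : (y == x) = false by rewrite eq_sym (negbTE nxy).
split.
- have := eq_o (Some (x, true)); have := eq_o (Some (x, false)).
  rewrite /= eqxx nyx ltF leq0n.
  case: (eqVneq x' x) => [-> //|nx'x]; case: (eqVneq y' x) => [_|ny'x].
    by rewrite ltn0.
  by move=> <-.
- have := eq_o (Some (y, true)); have := eq_o (Some (y, false)).
  rewrite /= eqxx (negbTE nxy) ltn0 ltnS ltnW //.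
  case: (eqVneq y' y) => [-> //|ny'y]; case: (eqVneq x' y) => [_|nx'y].
    by rewrite ltF.
  by move=> <-.
Qed.

Lemma has_boolean_realizer_ex : exists d, has_boolean_realizer P d.
Proof.
exists #|{: option (P * bool)}|; split; first by apply/card_gt0P; exists None.
exists move_order.
exists (fun v => [exists p : P * P,
  (p.1 < p.2)%O && (v == query move_order p.1 p.2)]).
split=> [i|x y /eqP nxy]; first exact/linear_order_key/move_key_inj.
split=> [lt_xy|/existsP[[x' y'] /= /andP[lt_xy' /eqP eq_q]]].
  by apply/existsP; exists (x, y); rewrite lt_xy eqxx.
by have [-> ->] := query_move_inj nxy (negbT (lt_eqF lt_xy')) eq_q.
Qed.

Lemma has_boolean_realizer_exb : exists d, `[< has_boolean_realizer P d >].
Proof. by have [d hd] := has_boolean_realizer_ex; exists d; apply/asboolP. Qed.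

Definition bdim : nat := ex_minn has_boolean_realizer_exb.

End Existence.

Arguments bdim {disp} P.

Definition del_point (disp : Order.disp_t) (P : finPOrderType disp) (x : P) :
  Type := {y : P | y != x}.

Section DelPoint.
Variables (disp : Order.disp_t) (P : finPOrderType disp) (x : P).

HB.instance Definition _ := SubFinite.on (del_point x).
HB.instance Definition _ :=
  [SubChoice_isSubPOrder of del_point x by <: with disp].

End DelPoint.

(* Main.v *)
(* Let L_0, ..., L_(d-1) realize P - {x}. Insert x at the bottom of every L_i and
   add a second copy of L_0 with x on top. The two copies of L_0 agree on a pair
   exactly when x is not in it, and otherwise they tell which of the two points
   is x. Two further orders, with blocks D < x < rest and rest < x < U, where D
   and U are the strict down-set and up-set of x, then decide z < x and x < z. *)
Require Import Defs.
From mathcomp Require Import all_boot all_order.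
From mathcomp Require Import boolp.

Set Implicit Arguments.
Unset Strict Implicit.
Unset Printing Implicit Defensive.

(** An ordinal sum of two blocks: the points where [p] holds lie below all others, and [R] orders
    each block. *)
Definition split_order (T : Type) (p : pred T) (R : rel T) : rel T :=
  fun y z => if p y == p z then R y z else p y.

Lemma split_order_linear (T : Type) (p : pred T) (R : rel T) :
  linear_order R -> linear_order (split_order p R).
Proof.
rewrite /split_order => -[Rxx Ranti Rtr Rtot]; split.
- by move=> y; rewrite eqxx.
- by move=> y z; have := @Ranti y z; case: (p y); case: (p z).
- by move=> z y w; have := @Rtr z y w; case: (p y); case: (p z); case: (p w).
- by move=> y z; have := Rtot y z; case: (p y); case: (p z).
Qed.

Section InsertPoint.
Variables (disp : Order.disp_t) (P : finPOrderType disp) (x : P).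

(* [insub] sends [x] to [None] and every other point to its copy in
   [del_point x]; [x] goes to the bottom if [b] holds and to the top otherwise. *)
Definition insert_point (b : bool) (L : rel (del_point x)) : rel P :=
  fun y z =>
  match insub y : option (del_point x), insub z : option (del_point x) with
  | Some u, Some v => L u v
  | None, Some _ => b
  | Some _, None => ~~ b
  | None, None => true
  end.

(** Indexed by both the point and its [insub] image, so that one case analysis replaces the two
    together. *)
Variant point_spec : P -> option (del_point x) -> Type :=
  | PointX : point_spec x None
  | PointDel (u : del_point x) : point_spec (val u) (Some u).

Lemma pointP y : point_spec y (insub y).
Proof.
case: insubP => [u _ <-|]; first exact: PointDel.
by rewrite negbK => /eqP ->; exact: PointX.
Qed.

Lemma insert_point_linear b (L : rel (del_point x)) :
  linear_order L -> linear_order (insert_point b L).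
Proof.
rewrite /insert_point => -[Lxx Lanti Ltr Ltot]; split.
- by move=> y; case: pointP.
- move=> y z; case: (pointP y) => [|u]; case: (pointP z) => [|v] //.
  + by case: b.
  + by case: b.
  + by move=> /Lanti ->.
- move=> z y w.
  case: (pointP y) => [|u]; case: (pointP z) => [|v]; case: (pointP w) => [|t];
    by [case: b | exact: Ltr].
- by move=> y z; case: (pointP y) => [|u]; case: (pointP z) => [|v] //; case: b.
Qed.

Lemma insert_point_val b (L : rel (del_point x)) (u v : del_point x) :
  insert_point b L (val u) (val v) = L u v.
Proof. by rewrite /insert_point !valK. Qed.

Lemma insert_point_xl b (L : rel (del_point x)) (v : del_point x) :
  insert_point b L x (val v) = b.
Proof. by rewrite /insert_point valK insubF ?eqxx. Qed.

Lemma insert_point_xr b (L : rel (del_point x)) (u : del_point x) :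
  insert_point b L (val u) x = ~~ b.
Proof. by rewrite /insert_point valK insubF ?eqxx. Qed.

Lemma has_boolean_realizer_add_point d :
  has_boolean_realizer (del_point x) d -> has_boolean_realizer P (3 + d).
Proof.
move=> [d_gt0 [L [tau [L_lin L_tau]]]]; split=> //.
(* A realizer is non-empty, so there is an order to duplicate. *)
pose i0 := Ordinal d_gt0.
pose M (j : 'I_3) : rel P :=
  match (j : nat) with
  | 0 => insert_point false (L i0)
  (* [x] falls in the upper block and is its least point, which gives D < [x] < rest. In the next
     order it falls in the lower block and is its greatest point, which gives rest < [x] < U. *)
  | 1 => split_order (fun y => (y < x)%O) (insert_point true (L i0))
  | _ => split_order (fun y => ~~ (x < y)%O) (insert_point false (L i0))
  end.
pose N (i : 'I_(3 + d)) : rel P :=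
  match split i with
  | inl j => M j
  | inr k => insert_point true (L k)
  end.
pose sigma (t : (3 + d).-tuple bool) : bool :=
  let top := tnth t (lshift d (inord 0)) in
  let bot := tnth t (rshift 3 i0) in
  if top == bot then tau [tuple tnth t (rshift 3 k) | k < d]
  (* The copies differ, so one point is [x]. As [bot] comes from the copy with [x] at the bottom, it
     holds exactly when the first point is [x]. *)
  else if bot then tnth t (lshift d (inord 2))
  else tnth t (lshift d (inord 1)).
have N_l j : N (lshift d j) = M j by rewrite /N (unsplitK (inl j)).
have N_r k : N (rshift 3 k) = insert_point true (L k).
  by rewrite /N (unsplitK (inr k)).
exists N, sigma; split.
  move=> i; rewrite /N; case: split => [j|k]; last exact: insert_point_linear.
  rewrite /M; case: (j : nat) => [|[|_]]; try exact: split_order_linear;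
    by try apply: split_order_linear; exact: insert_point_linear.
have sigmaE y z : sigma (query N y z) =
    if insert_point false (L i0) y z == insert_point true (L i0) y z then
      tau [tuple insert_point true (L k) y z | k < d]
    else if insert_point true (L i0) y z then
      split_order (fun t => ~~ (x < t)%O) (insert_point false (L i0)) y z
    else split_order (fun t => (t < x)%O) (insert_point true (L i0)) y z.
  rewrite /sigma /query !tnth_mktuple !N_l N_r /M !inordK //.
  case: ifP => // _; congr tau.
  by apply: eq_from_tnth => k; rewrite !tnth_mktuple N_r.
move=> y z; rewrite sigmaE.
case: (pointP y) => [|u]; case: (pointP z) => [|v] // neq.
(* First point [x]: the copies read false and true, and rest < [x] < U puts [x] below [val v]
   exactly when [val v] is in U. *)
- rewrite !insert_point_xl /= /split_order Order.POrderTheory.ltxx /=.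
  by rewrite insert_point_xl; case: (x < val v)%O.
(* Second point [x]: the copies read true and false, and D < [x] < rest puts [val u] below [x]
   exactly when [val u] is in D. *)
- rewrite !insert_point_xr /= /split_order Order.POrderTheory.ltxx /=.
  by rewrite insert_point_xr; case: (val u < x)%O.
(* Away from [x] both copies restrict to [L i0], so they agree and [tau] receives the original
   query. *)
- rewrite !insert_point_val eqxx.
  have -> : [tuple insert_point true (L k) (val u) (val v) | k < d]
            = query L u v.
    by apply: eq_from_tnth => k; rewrite !tnth_mktuple insert_point_val.
  by apply: L_tau => eq_uv; apply: neq; rewrite eq_uv.
Qed.

End InsertPoint.

Lemma bdim_realizer (disp : Order.disp_t) (P : finPOrderType disp) :
  has_boolean_realizer P (bdim P).
Proof. by rewrite /bdim; case: ex_minnP => d /asboolP. Qed.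

Lemma bdim_le (disp : Order.disp_t) (P : finPOrderType disp) d :
  has_boolean_realizer P d -> bdim P <= d.
Proof. by move=> hd; rewrite /bdim; case: ex_minnP => m _; apply; apply/asboolP. Qed.

Theorem theorem3p3 (disp : Order.disp_t) (P : finPOrderType disp) (x : P) :
  2 <= #|P| -> bdim P <= 3 + bdim (del_point x).
Proof.
move=> _; apply: bdim_le; apply: has_boolean_realizer_add_point.
exact: bdim_realizer.
Qed.
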